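(* Let $q\in\mathbb{C}$ with $|q|<1$, let $k$ be a non-negative integer, and let $b,x,y,z\in\mathbb{C}$ with $|xy|<1$, $|xz|<1$, $|by|<1$ and $|bz|<1$. Then \[ \sum_{n=0}^{\infty}\sum_{m=0}^{\infty}\Phi_{n+m}^{(q^k)}(b,x|q)\frac{y^n}{(q;q)_{n}}\frac{z^m}{(q;q)_{m}}=\frac{(q^{k}bz;q)_{\infty}}{(xy;q)_{\infty}(xz;q)_{\infty}(bz;q)_{\infty}}\;{}_{2}\varphi_{1}\left(\begin{array}{c} q^{k},\,xz\\ q^{k}bz\end{array};q,\,by\right). \]
   Context: For $a\in\mathbb{C}$ and integers $n\ge 0$, $(a;q)_n=\prod_{j=0}^{n-1}(1-q^j a)$ and $(a;q)_\infty=\prod_{j=0}^{\infty}(1-aq^j)$. The $q$-binomial coefficient is $\genfrac{[}{]}{0pt}{}{m}{j}_q=\frac{(q;q)_m}{(q;q)_j(q;q)_{m-j}}$. The homogeneous Hahn polynomials are $\Phi_{m}^{(\alpha)}(x,y|q)=\sum_{j=0}^{m}\genfrac{[}{]}{0pt}{}{m}{j}_{q}(\alpha;q)_{j}x^jy^{m-j}$; thus $\Phi_{m}^{(q^k)}(b,x|q)=\sum_{j=0}^{m}\genfrac{[}{]}{0pt}{}{m}{j}_{q}(q^k;q)_{j}b^jx^{m-j}$. The basic hypergeometric series is \[ {}_{2}\varphi_{1}\left(\begin{array}{c} a_1,a_2\\ b_1\end{array};q,w\right)=\sum_{l=0}^{\infty}\frac{(a_1;q)_l(a_2;q)_l}{(q;q)_l(b_1;q)_l}w^l,\qquad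 |w|<1. \] *)

(* Defs.v *)
(* Stdlib reals and Coquelicot's complex numbers. *)
From Stdlib Require Export Reals.
From Coquelicot Require Export Coquelicot.

Open Scope C_scope.

Fixpoint qpoch (a q : C) (n : nat) : C :=
  match n with
  | O => 1
  | S j => qpoch a q j * (1 - q ^ j * a)
  end.

(* Limit of the partial products; as for [RInt], the value is meaningful only
   when the limit exists, which is the case whenever [Cmod q < 1]. *)
Definition qpoch_inf (a q : C) : C :=
  iota (T := C_CompleteNormedModule)
    (fun l : C => filterlim (qpoch a q) eventually (locally l)).

Definition qbinom (q : C) (m j : nat) : C :=
  qpoch q q m / (qpoch q q j * qpoch q q (m - j)).

Definition hahn (q alpha : C) (m : nat) (x y : C) : C :=
  sum_n (G := C_AbelianMonoid)
    (fun j => qbinom q m j * qpoch alpha q j * x ^ j * y ^ (m - j)) m.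

(* [C] carries normed-module structures over both [R] and [C]; these fix the
   latter. *)
Definition is_Cseries (u : nat -> C) (l : C) : Prop :=
  @is_series C_AbsRing C_NormedModule u l.

Definition ex_Cseries (u : nat -> C) : Prop :=
  @ex_series C_AbsRing C_NormedModule u.

(* Meaningful only when the series converges. *)
Definition CSeries (u : nat -> C) : C :=
  iota (T := C_CompleteNormedModule) (is_Cseries u).

Definition phi21 (a1 a2 b1 q w : C) : C :=
  CSeries (fun l =>
    qpoch a1 q l * qpoch a2 q l / (qpoch q q l * qpoch b1 q l) * w ^ l).

(* Main.v *)
(* Write a = q^k and G_n(z) for the sum over m of
   Phi_(n+m)(b,x) z^m / (q;q)_m.  By the q-binomial theorem and a Cauchy product,
   G_0(z) = (abz)_oo / ((bz)_oo (xz)_oo), and the q-difference quotient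
   (G_n(z) - G_n(qz)) / z equals G_(n+1)(z).  A q-Leibniz rule then gives
   G_n(z) = G_0(z) * sum_k [n,k] (a)_k (xz)_k / (abz)_k b^k x^(n-k), and summing
   G_n(z) y^n / (q)_n over n is a Cauchy product of the 2phi1 series with
   Euler's series for 1 / (xy)_oo.

   Convergence of the infinite products needs no product theory: if h(w) is the
   sum of w^n / (q)_n, then (w)_n h(w) = h(q^n w) -> h(0) = 1, so h(w) is nonzero
   and (w)_n -> 1 / h(w). *)
Require Import Defs.
From Stdlib Require Import Lra Lia.

(** * Limits and series in [C], reduced to real and imaginary parts *)

Lemma is_Climit_Re_Im (u : nat -> C) (l : C) :
  filterlim u eventually (locally l) <->
  is_lim_seq (fun n => Re (u n)) (Re l) /\ is_lim_seq (fun n => Im (u n)) (Im l).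
Proof.
  split.
  - intros H; split; apply filterlim_locally; intros eps;
      generalize (proj1 (filterlim_locally _ _) H eps); apply filter_imp;
      intros n [H1 H2]; assumption.
  - intros [H1 H2]. apply filterlim_locally. intros eps.
    generalize (filter_and _ _ (proj1 (filterlim_locally _ _) H1 eps)
      (proj1 (filterlim_locally _ _) H2 eps)).
    apply filter_imp. intros n [H3 H4]. split; assumption.
Qed.

Lemma Re_sum_n (u : nat -> C) (n : nat) :
  Re (sum_n (G := C_AbelianMonoid) u n) = sum_n (fun k => Re (u k)) n.
Proof.
  induction n as [|n IH].
  - now rewrite !sum_O.
  - rewrite !sum_Sn, <- IH. reflexivity.
Qed.

Lemma Im_sum_n (u : nat -> C) (n : nat) :
  Im (sum_n (G := C_AbelianMonoid) u n) = sum_n (fun k => Im (u k)) n.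
Proof.
  induction n as [|n IH].
  - now rewrite !sum_O.
  - rewrite !sum_Sn, <- IH. reflexivity.
Qed.

Lemma is_Cseries_Re_Im (u : nat -> C) (l : C) :
  is_Cseries u l <->
  is_series (fun n => Re (u n)) (Re l) /\ is_series (fun n => Im (u n)) (Im l).
Proof.
  unfold is_Cseries, is_series. split.
  - intros H. apply is_Climit_Re_Im in H. destruct H as [H1 H2]. split.
    + exact (is_lim_seq_ext _ _ (Finite (Re l)) (Re_sum_n u) H1).
    + exact (is_lim_seq_ext _ _ (Finite (Im l)) (Im_sum_n u) H2).
  - intros [H1 H2]. apply is_Climit_Re_Im. split.
    + exact (is_lim_seq_ext _ _ (Finite (Re l)) (fun n => eq_sym (Re_sum_n u n)) H1).
    + exact (is_lim_seq_ext _ _ (Finite (Im l)) (fun n => eq_sym (Im_sum_n u n)) H2).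
Qed.

Lemma CSeries_eq (u : nat -> C) (l : C) : is_Cseries u l -> CSeries u = l.
Proof.
  intros H.
  exact (iota_filterlim_locally (V := C_CompleteNormedModule) _ _ H).
Qed.

Lemma CSeries_correct (u : nat -> C) : ex_Cseries u -> is_Cseries u (CSeries u).
Proof.
  intros [l H]. now rewrite (CSeries_eq _ _ H).
Qed.

Lemma is_Cseries_ext (u v : nat -> C) (l : C) :
  (forall n, u n = v n) -> is_Cseries u l -> is_Cseries v l.
Proof. intros H. now apply is_series_ext. Qed.

Lemma is_Cseries_eq_sum (u : nat -> C) (l l' : C) :
  l = l' -> is_Cseries u l -> is_Cseries u l'.
Proof. now intros <-. Qed.

Lemma is_Cseries_unique (u : nat -> C) (l l' : C) :
  is_Cseries u l -> is_Cseries u l' -> l = l'.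
Proof. intros H H'. now rewrite <- (CSeries_eq _ _ H), <- (CSeries_eq _ _ H'). Qed.

Lemma is_Cseries_scal (c : C) (u : nat -> C) (l : C) :
  is_Cseries u l -> is_Cseries (fun n => c * u n) (c * l).
Proof. intros H. exact (is_series_scal c u l H). Qed.

Lemma is_Cseries_minus (u v : nat -> C) (l l' : C) :
  is_Cseries u l -> is_Cseries v l' -> is_Cseries (fun n => u n - v n) (l - l').
Proof. intros H H'. exact (is_series_minus u v l l' H H'). Qed.

Lemma is_Cseries_shift (u : nat -> C) (l : C) :
  is_Cseries u l -> is_Cseries (fun n => u (S n)) (l - u O).
Proof.
  intros H. apply is_series_incr_1.
  eapply is_Cseries_eq_sum, H.
  change (l = l - u O + u O). ring.
Qed.

Lemma is_Cseries_single (u : nat -> C) :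
  (forall n, u (S n) = 0) -> is_Cseries u (u O).
Proof.
  intros H. unfold is_Cseries, is_series.
  apply filterlim_ext with (fun _ => u O).
  - induction x as [|n IH].
    + now rewrite sum_O.
    + rewrite sum_Sn, <- IH, H. change (u O = u O + 0). ring.
  - apply filterlim_const.
Qed.

(** * Absolute convergence, Cauchy products, limits and the ratio test *)

Definition abs_summable (u : nat -> C) : Prop := ex_series (fun n => Cmod (u n)).

Lemma abs_summable_ex (u : nat -> C) : abs_summable u -> ex_Cseries u.
Proof.
  intros H.
  apply (ex_series_le (V := C_CompleteNormedModule) u (fun n => Cmod (u n))).
  - intros n. apply Rle_refl.
  - exact H.
Qed.

Lemma ex_series_Rabs_part (f : C -> R) (u : nat -> C) :
  (forall c, Rabs (f c) <= Cmod c)%R ->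
  abs_summable u -> ex_series (fun n => Rabs (f (u n))).
Proof.
  intros Hf H.
  apply (ex_series_le (V := R_CompleteNormedModule) _ (fun n => Cmod (u n))).
  - intros n. unfold norm; simpl. unfold abs; simpl. rewrite Rabs_Rabsolu. apply Hf.
  - exact H.
Qed.

Lemma im_le_Cmod (c : C) : (Rabs (Im c) <= Cmod c)%R.
Proof. eapply Rle_trans, Rmax_Cmod. apply Rmax_r. Qed.

(** Splitting into real and imaginary parts gives four real Cauchy products, which converge because
    both factors are absolutely summable. *)
Lemma is_Cseries_mult (u v : nat -> C) (l l' : C) :
  is_Cseries u l -> is_Cseries v l' -> abs_summable u -> abs_summable v ->
  is_Cseries
    (fun n => sum_n (G := C_AbelianMonoid) (fun k => u k * v (n - k)%nat) n) (l * l').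
Proof.
  intros Hu Hv Au Av.
  apply is_Cseries_Re_Im in Hu. apply is_Cseries_Re_Im in Hv.
  destruct Hu as [Hu1 Hu2], Hv as [Hv1 Hv2].
  pose proof (ex_series_Rabs_part Re u re_le_Cmod Au) as Au1.
  pose proof (ex_series_Rabs_part Im u im_le_Cmod Au) as Au2.
  pose proof (ex_series_Rabs_part Re v re_le_Cmod Av) as Av1.
  pose proof (ex_series_Rabs_part Im v im_le_Cmod Av) as Av2.
  apply is_Cseries_Re_Im. split.
  - generalize (is_series_minus _ _ _ _ (is_series_mult _ _ _ _ Hu1 Hv1 Au1 Av1)
      (is_series_mult _ _ _ _ Hu2 Hv2 Au2 Av2)).
    apply is_series_ext. intros n. rewrite Re_sum_n.
    rewrite sum_n_Reals. symmetry. apply minus_sum.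
  - generalize (is_series_plus _ _ _ _ (is_series_mult _ _ _ _ Hu1 Hv2 Au1 Av2)
      (is_series_mult _ _ _ _ Hu2 Hv1 Au2 Av1)).
    apply is_series_ext. intros n. rewrite Im_sum_n.
    rewrite sum_n_Reals. symmetry. apply plus_sum.
Qed.

Lemma is_Cseries_Cmod_le (u : nat -> C) (v : nat -> R) (l : C) (L : R) :
  is_Cseries u l -> is_series v L -> (forall n, Cmod (u n) <= v n)%R ->
  (Cmod l <= L)%R.
Proof.
  intros Hu Hv H.
  assert (Hn : is_lim_seq (fun n => Cmod (sum_n (G := C_AbelianMonoid) u n)) (Cmod l)).
  { apply (filterlim_comp _ _ _ (sum_n (G := C_AbelianMonoid) u)
      (norm (V := C_NormedModule)) eventually (locally (T := C_NormedModule) l)).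
    - exact Hu.
    - apply (filterlim_norm (V := C_NormedModule)). }
  refine (is_lim_seq_le _ _ (Cmod l) L _ Hn Hv).
  intros n. eapply Rle_trans.
  - exact (norm_sum_n_m (V := C_NormedModule) u 0 n).
  - apply sum_n_m_le. exact H.
Qed.

Lemma is_Climit_Cmod (u : nat -> C) (l : C) :
  is_lim_seq (fun n => Cmod (u n - l)) 0 -> filterlim u eventually (locally l).
Proof.
  intros H.
  apply (filterlim_locally_ball_norm (U := C_NormedModule)). intros eps.
  generalize (proj2 (is_lim_seq_spec _ _) H eps). apply filter_imp. intros n Hn.
  rewrite Rminus_0_r in Hn.
  exact (Rle_lt_trans _ _ _ (Rle_abs _) Hn).
Qed.

Lemma is_Climit_mult (u v : nat -> C) (l l' : C) :
  filterlim u eventually (locally l) -> filterlim v eventually (locally l') ->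
  filterlim (fun n => u n * v n) eventually (locally (l * l')).
Proof.
  intros Hu Hv. apply is_Climit_Re_Im in Hu, Hv. apply is_Climit_Re_Im.
  destruct Hu as [Hu1 Hu2], Hv as [Hv1 Hv2].
  split.
  - apply (is_lim_seq_minus' _ _ (Re l * Re l') (Im l * Im l')); now apply is_lim_seq_mult'.
  - apply (is_lim_seq_plus' _ _ (Re l * Im l') (Im l * Re l')); now apply is_lim_seq_mult'.
Qed.

Lemma is_Climit_unique (u : nat -> C) (l l' : C) :
  filterlim u eventually (locally l) -> filterlim u eventually (locally l') -> l = l'.
Proof. apply (filterlim_locally_unique (V := C_NormedModule)). Qed.

(** Ratio test with the ratio bound in product form: no quotient of terms is taken, so terms may
    vanish, as they do when [qpoch a q] terminates. *)
Lemma abs_summable_ratio (u : nat -> C) (rho : nat -> R) (r : R) :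
  (0 <= r < 1)%R -> is_lim_seq rho r ->
  (forall n, Cmod (u (S n)) <= rho n * Cmod (u n))%R -> abs_summable u.
Proof.
  (* [s] is the midpoint of [r] and 1. From some [N] on, [rho] stays below [s], and the geometric
     series of ratio [s] dominates. *)
  intros Hr Hrho H. set (s := ((1 + r) / 2)%R).
  assert (Hs : (0 < (1 - r) / 2)%R) by lra.
  destruct (proj2 (is_lim_seq_spec _ _) Hrho (mkposreal _ Hs)) as [N HN].
  simpl in HN.
  apply (ex_series_incr_n _ N).
  apply (ex_series_le (V := R_CompleteNormedModule) _ (fun n => Cmod (u N) * s ^ n)%R).
  - intros n. unfold norm; simpl; unfold abs; simpl.
    rewrite Rabs_pos_eq by apply Cmod_ge_0.
    induction n as [|n IH].
    + rewrite Nat.add_0_r. simpl. lra.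
    + rewrite Nat.add_succ_r. eapply Rle_trans; [apply H|].
      assert (rho (N + n)%nat <= s)%R.
      { specialize (HN (N + n)%nat (Nat.le_add_r _ _)). apply Rabs_def2 in HN.
        unfold s. lra. }
      apply Rle_trans with (s * Cmod (u (N + n)%nat))%R.
      * apply Rmult_le_compat_r; [apply Cmod_ge_0 | assumption].
      * simpl. replace (Cmod (u N) * (s * s ^ n))%R with (s * (Cmod (u N) * s ^ n))%R by ring.
        apply Rmult_le_compat_l; [unfold s; lra | exact IH].
  - apply (ex_series_scal (V := R_NormedModule)). apply ex_series_geom.
    rewrite Rabs_pos_eq; unfold s; lra.
Qed.

Lemma one_minus_neq_0 (c : C) : (Cmod c < 1)%R -> 1 - c <> 0.
Proof.
  intros H E. replace c with (RtoC 1) in H.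
  - rewrite Cmod_1 in H. lra.
  - rewrite <- (Cplus_0_r c), <- E. ring.
Qed.

Lemma Cmod_pow_le_1 (q : C) (n : nat) : (Cmod q <= 1)%R -> (Cmod (q ^ n) <= 1)%R.
Proof.
  intros H. rewrite Cmod_pow. rewrite <- (pow1 n). apply pow_incr.
  split; [apply Cmod_ge_0 | exact H].
Qed.

Lemma Cmod_mult_lt_1 (c a : C) : (Cmod c <= 1)%R -> (Cmod a < 1)%R -> (Cmod (c * a) < 1)%R.
Proof.
  intros Hc Ha. rewrite Cmod_mult.
  pose proof (Cmod_ge_0 c). pose proof (Cmod_ge_0 a). nra.
Qed.

(** * Finite q-Pochhammer symbols and convergence of the 2phi1 series *)

Section QSeries.

Variable q : C.
Hypothesis Hq : (Cmod q < 1)%R.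

Lemma one_minus_qpow_neq_0 (a : C) (n : nat) : (Cmod a < 1)%R -> 1 - q ^ n * a <> 0.
Proof.
  intros Ha. apply one_minus_neq_0, Cmod_mult_lt_1; [|exact Ha].
  apply Cmod_pow_le_1. lra.
Qed.

Lemma qpoch_neq_0 (a : C) (n : nat) : (Cmod a < 1)%R -> qpoch a q n <> 0.
Proof.
  intros Ha. induction n as [|n IH]; simpl.
  - apply C1_nz.
  - apply Cmult_neq_0; [exact IH | now apply one_minus_qpow_neq_0].
Qed.

Lemma qpoch_0_l (n : nat) : qpoch 0 q n = 1.
Proof. induction n as [|n IH]; simpl; [reflexivity | rewrite IH; ring]. Qed.

(** Peels off the first factor, where the definition peels off the last; comparing the two relates
    [qpoch (q * a) q n] to [qpoch a q n]. *)
Lemma qpoch_Sl (a : C) (n : nat) : qpoch a q (S n) = (1 - a) * qpoch (q * a) q n.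
Proof.
  induction n as [|n IH].
  - simpl. ring.
  - change (qpoch a q (S (S n))) with (qpoch a q (S n) * (1 - q ^ (S n) * a)).
    rewrite IH. simpl. ring.
Qed.

Lemma is_lim_seq_Cmod_qpow : is_lim_seq (fun n => Cmod (q ^ n)) 0.
Proof.
  apply is_lim_seq_ext with (fun n => Cmod q ^ n)%R.
  - intros n. symmetry. apply Cmod_pow.
  - apply is_lim_seq_geom. rewrite Rabs_pos_eq; [exact Hq | apply Cmod_ge_0].
Qed.

Lemma is_lim_seq_Cmod_one_minus (a : C) :
  is_lim_seq (fun n => Cmod (1 - q ^ n * a)) 1.
Proof.
  assert (H0 : is_lim_seq (fun n => Cmod (q ^ n) * Cmod a)%R 0).
  { replace (Finite 0) with (Rbar_mult 0 (Cmod a)) by (simpl; f_equal; ring).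
    apply is_lim_seq_scal_r, is_lim_seq_Cmod_qpow. }
  apply is_lim_seq_le_le with
    (fun n => 1 - Cmod (q ^ n) * Cmod a)%R (fun n => 1 + Cmod (q ^ n) * Cmod a)%R.
  - intros n. rewrite <- Cmod_mult. split.
    + pose proof (Cmod_triangle (1 - q ^ n * a) (q ^ n * a)) as T.
      replace (1 - q ^ n * a + q ^ n * a) with (RtoC 1) in T by ring.
      rewrite Cmod_1 in T. lra.
    + pose proof (Cmod_triangle 1 (- (q ^ n * a))) as T.
      rewrite Cmod_1, Cmod_opp in T. exact T.
  - replace (Finite 1) with (Finite (1 - 0)) by (f_equal; ring).
    apply is_lim_seq_minus'; [apply is_lim_seq_const | exact H0].
  - replace (Finite 1) with (Finite (1 + 0)) by (f_equal; ring).
    apply is_lim_seq_plus'; [apply is_lim_seq_const | exact H0].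
Qed.

Lemma phi21_abs_summable (a1 a2 b1 w : C) :
  (Cmod b1 < 1)%R -> (Cmod w < 1)%R ->
  abs_summable (fun l =>
    qpoch a1 q l * qpoch a2 q l / (qpoch q q l * qpoch b1 q l) * w ^ l).
Proof.
  intros Hb Hw.
  (* [rho] is the exact ratio of consecutive moduli. Each factor [Cmod (1 - q ^ n * c)] tends to 1,
     so the limit is [Cmod w]; it is left unsimplified to match the limit rules for products and
     quotients. *)
  apply abs_summable_ratio with
    (rho := fun n => (Cmod (1 - q ^ n * a1) * Cmod (1 - q ^ n * a2) /
      (Cmod (1 - q ^ n * q) * Cmod (1 - q ^ n * b1)) * Cmod w)%R)
    (r := (1 * 1 / (1 * 1) * Cmod w)%R).
  - pose proof (Cmod_ge_0 w). lra.
  - apply is_lim_seq_mult'; [|apply is_lim_seq_const].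
    apply is_lim_seq_div'; [| |lra]; apply is_lim_seq_mult'; apply is_lim_seq_Cmod_one_minus.
  - intros n. apply Req_le.
    pose proof (one_minus_qpow_neq_0 q n Hq). pose proof (one_minus_qpow_neq_0 b1 n Hb).
    pose proof (qpoch_neq_0 q n Hq). pose proof (qpoch_neq_0 b1 n Hb).
    rewrite <- !Cmod_mult, <- Cmod_div, <- !Cmod_mult by now apply Cmult_neq_0.
    f_equal. simpl. field. repeat split; assumption.
Qed.

(** * The q-binomial theorem and infinite q-Pochhammer products *)

(** The 1phi0 series of the q-binomial theorem. At [a = 0] it is Euler's series for the reciprocal
    of [qpoch_inf w q]. *)
Definition phi10 (a w : C) : C :=
  CSeries (fun n => qpoch a q n / qpoch q q n * w ^ n).

(** This is the 2phi1 series with second upper and lower parameters 0, since [qpoch 0 q n] is 1. *)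
Lemma phi10_abs_summable (a w : C) :
  (Cmod w < 1)%R -> abs_summable (fun n => qpoch a q n / qpoch q q n * w ^ n).
Proof.
  intros Hw. eapply ex_series_ext, (phi21_abs_summable a 0 0 w); [|rewrite Cmod_0; lra|exact Hw].
  intros n. simpl. rewrite qpoch_0_l. f_equal. field. now apply qpoch_neq_0.
Qed.

Lemma is_Cseries_phi10 (a w : C) :
  (Cmod w < 1)%R -> is_Cseries (fun n => qpoch a q n / qpoch q q n * w ^ n) (phi10 a w).
Proof. intros Hw. now apply CSeries_correct, abs_summable_ex, phi10_abs_summable. Qed.

(** The coefficients satisfy c_(n+1) (1 - q^(n+1)) = c_n (1 - a q^n). Summed against w^(n+1), this
    reads f(w) - f(qw) = w (f(w) - a f(qw)), with f = [phi10 a]. *)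
Lemma phi10_qshift (a w : C) :
  (Cmod w < 1)%R -> (1 - w) * phi10 a w = (1 - a * w) * phi10 a (q * w).
Proof.
  intros Hw.
  assert (Hqw : (Cmod (q * w) < 1)%R) by (apply Cmod_mult_lt_1; lra).
  pose proof (is_Cseries_phi10 a w Hw) as S0.
  pose proof (is_Cseries_phi10 a (q * w) Hqw) as S1.
  (* The constant terms of the two series cancel, so dropping index 0 leaves the sum unchanged. *)
  pose proof (is_Cseries_shift _ _ (is_Cseries_minus _ _ _ _ S0 S1)) as L.
  pose proof (is_Cseries_scal w _ _
    (is_Cseries_minus _ _ _ _ S0 (is_Cseries_scal a _ _ S1))) as R.
  assert (E : phi10 a w - phi10 a (q * w)
    - (qpoch a q 0 / qpoch q q 0 * w ^ 0 - qpoch a q 0 / qpoch q q 0 * (q * w) ^ 0)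
    = w * (phi10 a w - a * phi10 a (q * w))).
  { eapply is_Cseries_unique; [exact L|]. eapply is_Cseries_ext, R.
    intros n. simpl. rewrite !Cpow_mult_l. field.
    split; [now apply one_minus_qpow_neq_0 | now apply qpoch_neq_0]. }
  simpl in E.
  transitivity (phi10 a (q * w) * (1 - a * w) + ((phi10 a w - phi10 a (q * w) - (1 / 1 * 1 - 1 / 1 * 1)) - w * (phi10 a w - a * phi10 a (q * w)))).
  - field.
  - rewrite E. ring.
Qed.

Lemma phi10_qpoch (a w : C) (n : nat) :
  (Cmod w < 1)%R -> qpoch w q n * phi10 a w = qpoch (a * w) q n * phi10 a (q ^ n * w).
Proof.
  intros Hw. induction n as [|n IH]; simpl.
  - now rewrite !Cmult_1_l.
  - transitivity ((1 - q ^ n * w) * (qpoch w q n * phi10 a w)); [ring|].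
    rewrite IH.
    transitivity (qpoch (a * w) q n * ((1 - q ^ n * w) * phi10 a (q ^ n * w))); [ring|].
    rewrite phi10_qshift.
    + rewrite (Cmult_assoc q). ring.
    + apply Cmod_mult_lt_1; [apply Cmod_pow_le_1; lra | exact Hw].
Qed.

(** Every term after the constant 1 carries a factor [q ^ n], so the distance to 1 is at most
    [Cmod (q ^ n)] times the sum [M] of the moduli of those terms at [w]. *)
Lemma phi10_qpow_lim (a w : C) :
  (Cmod w < 1)%R ->
  filterlim (fun n => phi10 a (q ^ n * w)) eventually (locally (RtoC 1)).
Proof.
  intros Hw.
  pose proof (phi10_abs_summable a w Hw) as A.
  apply (ex_series_incr_1 (V := R_NormedModule)) in A. destruct A as [M HM].
  apply is_Climit_Cmod.
  apply is_lim_seq_le_le with (fun _ => 0%R) (fun n => Cmod (q ^ n) * M)%R.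
  - intros n. split; [apply Cmod_ge_0|].
    assert (Hn : (Cmod (q ^ n) <= 1)%R) by (apply Cmod_pow_le_1; lra).
    apply (is_Cseries_Cmod_le (fun j => qpoch a q (S j) / qpoch q q (S j) * (q ^ n * w) ^ S j)
      (fun j => Cmod (q ^ n) * Cmod (qpoch a q (S j) / qpoch q q (S j) * w ^ S j))%R).
    + eapply is_Cseries_eq_sum.
      2: apply (is_Cseries_shift (fun j => qpoch a q j / qpoch q q j * (q ^ n * w) ^ j)),
        is_Cseries_phi10; now apply Cmod_mult_lt_1.
      simpl. field.
    + exact (is_series_scal (V := R_NormedModule) (Cmod (q ^ n)) _ _ HM).
    + intros j. rewrite <- Cmod_mult, Cpow_mult_l.
      (* One factor [q ^ n] is kept for the bound; the remaining [(q ^ n) ^ j] has modulus at most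
         1. *)
      replace (qpoch a q (S j) / qpoch q q (S j) * ((q ^ n) ^ S j * w ^ S j))
        with ((q ^ n) ^ j * (q ^ n * (qpoch a q (S j) / qpoch q q (S j) * w ^ S j)))
        by (change ((q ^ n) ^ S j) with (q ^ n * (q ^ n) ^ j); ring).
      rewrite Cmod_mult. rewrite <- Rmult_1_l. apply Rmult_le_compat_r; [apply Cmod_ge_0|].
      now apply Cmod_pow_le_1.
  - apply is_lim_seq_const.
  - replace (Finite 0) with (Rbar_mult 0 M) by (simpl; f_equal; ring).
    apply is_lim_seq_scal_r, is_lim_seq_Cmod_qpow.
Qed.

Lemma qpoch_phi10_lim (w : C) :
  (Cmod w < 1)%R ->
  filterlim (fun n => qpoch w q n * phi10 0 w) eventually (locally (RtoC 1)).
Proof.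
  intros Hw. eapply filterlim_ext, (phi10_qpow_lim 0 w Hw).
  intros n. simpl. rewrite phi10_qpoch by exact Hw.
  rewrite Cmult_0_l, qpoch_0_l. ring.
Qed.

(** Otherwise a sequence of zeros would tend to 1. *)
Lemma phi10_0_neq_0 (w : C) : (Cmod w < 1)%R -> phi10 0 w <> 0.
Proof.
  intros Hw E. pose proof (qpoch_phi10_lim w Hw) as L. rewrite E in L.
  apply C1_nz. apply (is_Climit_unique _ _ _ L).
  apply filterlim_ext with (fun _ => RtoC 0); [intros n; simpl; ring | apply filterlim_const].
Qed.

Lemma qpoch_lim_inv_phi10 (w : C) :
  (Cmod w < 1)%R -> filterlim (qpoch w q) eventually (locally (/ phi10 0 w)).
Proof.
  intros Hw. pose proof (phi10_0_neq_0 w Hw) as N.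
  rewrite <- (Cmult_1_l (/ phi10 0 w)).
  eapply filterlim_ext, (is_Climit_mult _ _ _ _ (qpoch_phi10_lim w Hw) (filterlim_const _)).
  intros n. simpl. field. exact N.
Qed.

Lemma qpoch_inf_eq (w : C) : (Cmod w < 1)%R -> qpoch_inf w q = / phi10 0 w.
Proof.
  intros Hw.
  exact (iota_filterlim_locally (V := C_CompleteNormedModule) _ _ (qpoch_lim_inv_phi10 w Hw)).
Qed.

Lemma qpoch_inf_neq_0 (w : C) : (Cmod w < 1)%R -> qpoch_inf w q <> 0.
Proof.
  intros Hw E. rewrite qpoch_inf_eq in E by exact Hw.
  apply C1_nz. rewrite <- (Cinv_l (phi10 0 w)), E; [ring | now apply phi10_0_neq_0].
Qed.

Lemma qpoch_inf_qshift (w : C) :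
  (Cmod w < 1)%R -> qpoch_inf w q = (1 - w) * qpoch_inf (q * w) q.
Proof.
  intros Hw.
  assert (Hqw : (Cmod (q * w) < 1)%R) by (apply Cmod_mult_lt_1; lra).
  rewrite !qpoch_inf_eq by assumption.
  pose proof (phi10_0_neq_0 w Hw). pose proof (phi10_0_neq_0 _ Hqw).
  pose proof (phi10_qshift 0 w Hw) as E. rewrite Cmult_0_l in E.
  replace (phi10 0 (q * w)) with ((1 - w) * phi10 0 w) by (rewrite E; ring).
  field. split; [assumption | now apply one_minus_neq_0].
Qed.

(** Let [n] tend to infinity in [phi10_qpoch]: the last factor tends to 1 and the finite products
    tend to the infinite ones. *)
Lemma q_binomial_theorem (a w : C) :
  (Cmod w < 1)%R -> (Cmod (a * w) < 1)%R ->
  phi10 a w = qpoch_inf (a * w) q / qpoch_inf w q.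
Proof.
  intros Hw Haw.
  assert (E : qpoch_inf w q * phi10 a w = qpoch_inf (a * w) q * 1).
  { apply (is_Climit_unique (fun n => qpoch w q n * phi10 a w)).
    - apply is_Climit_mult; [|apply filterlim_const].
      rewrite qpoch_inf_eq by exact Hw. now apply qpoch_lim_inv_phi10.
    - eapply filterlim_ext.
      + intros n. symmetry. now apply phi10_qpoch.
      + apply is_Climit_mult; [|now apply phi10_qpow_lim].
        rewrite qpoch_inf_eq by exact Haw. now apply qpoch_lim_inv_phi10. }
  rewrite Cmult_1_r in E. rewrite <- E. field. now apply qpoch_inf_neq_0.
Qed.

Lemma qpoch_inf_0_l : qpoch_inf 0 q = 1.
Proof.
  apply (iota_filterlim_locally (V := C_CompleteNormedModule) _ (RtoC 1)).
  apply filterlim_ext with (fun _ => RtoC 1); [intros n; now rewrite qpoch_0_l | apply filterlim_const].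
Qed.

Lemma is_Cseries_euler (w : C) :
  (Cmod w < 1)%R -> is_Cseries (fun n => w ^ n / qpoch q q n) (/ qpoch_inf w q).
Proof.
  intros Hw. rewrite qpoch_inf_eq by exact Hw.
  apply is_Cseries_ext with (fun n => qpoch 0 q n / qpoch q q n * w ^ n).
  - intros n. rewrite qpoch_0_l. field. now apply qpoch_neq_0.
  - eapply is_Cseries_eq_sum; [|now apply is_Cseries_phi10].
    field. now apply phi10_0_neq_0.
Qed.

Lemma euler_abs_summable (w : C) :
  (Cmod w < 1)%R -> abs_summable (fun n => w ^ n / qpoch q q n).
Proof.
  intros Hw. eapply ex_series_ext, (phi10_abs_summable 0 w Hw).
  intros n. simpl. rewrite qpoch_0_l. f_equal. field. now apply qpoch_neq_0.
Qed.

(** * q-binomial coefficients and the q-Pascal rule *)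

Lemma qbinom_0_r (n : nat) : qbinom q n 0 = 1.
Proof.
  unfold qbinom. rewrite Nat.sub_0_r. simpl. field. now apply qpoch_neq_0.
Qed.

Lemma qbinom_diag (n : nat) : qbinom q n n = 1.
Proof.
  unfold qbinom. rewrite Nat.sub_diag. simpl. field. now apply qpoch_neq_0.
Qed.

Lemma qbinom_pascal (n k : nat) :
  (S k <= n)%nat ->
  qbinom q (S n) (S k) = qbinom q n k + q ^ (S k) * qbinom q n (S k).
Proof.
  intros H. unfold qbinom.
  replace (S n - S k)%nat with (S (n - S k)) by lia.
  replace (n - k)%nat with (S (n - S k)) by lia.
  set (m := (n - S k)%nat).
  (* With [m = n - k - 1], every power of [q] is expressed through [q ^ k] and [q ^ m], and the
     claim becomes a rational identity. *)
  assert (E : q ^ n = q ^ k * q * q ^ m).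
  { replace n with (k + 1 + m)%nat by (unfold m; lia).
    rewrite !Cpow_add_r. simpl. ring. }
  simpl. rewrite E. field.
  repeat split; first [now apply qpoch_neq_0 | now apply one_minus_qpow_neq_0].
Qed.

(** The combinatorial half of the q-Leibniz rule: by the q-Pascal rule, raising [n] by one amounts
    to replacing [U k] with [U (S k) + x * q ^ k * U k], the shape produced by
    [hahn_kernel_qdiff]. *)
Lemma qbinom_sum_S (x : C) (U : nat -> C) (n : nat) :
  sum_n (G := C_AbelianMonoid) (fun k => qbinom q (S n) k * U k * x ^ (S n - k)) (S n) =
  sum_n (G := C_AbelianMonoid)
    (fun k => qbinom q n k * (U (S k) + x * q ^ k * U k) * x ^ (n - k)) n.
Proof.
  (* Partial sums of the two sides differ by a single boundary term. *)
  assert (H : forall N, (N <= n)%nat ->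
    sum_n (G := C_AbelianMonoid)
      (fun k => qbinom q n k * (U (S k) + x * q ^ k * U k) * x ^ (n - k)) N =
    sum_n (G := C_AbelianMonoid) (fun k => qbinom q (S n) k * U k * x ^ (S n - k)) N
      + qbinom q n N * U (S N) * x ^ (n - N)).
  { induction N as [|N IH]; intros HN.
    - rewrite !sum_O, !qbinom_0_r, !Nat.sub_0_r. simpl. ring.
    - rewrite !sum_Sn, IH by lia. rewrite qbinom_pascal by exact HN.
      replace (S n - S N)%nat with (S (n - S N)) by lia.
      replace (n - N)%nat with (S (n - S N)) by lia.
      change (@plus C_AbelianMonoid) with Cplus. simpl. ring. }
  rewrite H by lia. rewrite sum_Sn, !qbinom_diag, !Nat.sub_diag. reflexivity.
Qed.

End QSeries.

Lemma Csum_n_mult_l (c : C) (u : nat -> C) (n : nat) :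
  c * sum_n (G := C_AbelianMonoid) u n = sum_n (G := C_AbelianMonoid) (fun k => c * u k) n.
Proof. symmetry. apply (sum_n_mult_l (K := C_Ring)). Qed.

Lemma Csum_n_ext_loc (u v : nat -> C) (n : nat) :
  (forall k, (k <= n)%nat -> u k = v k) ->
  sum_n (G := C_AbelianMonoid) u n = sum_n (G := C_AbelianMonoid) v n.
Proof. apply (sum_n_ext_loc (G := C_AbelianMonoid)). Qed.

Lemma Csum_n_minus (u v : nat -> C) (n : nat) :
  sum_n (G := C_AbelianMonoid) u n - sum_n (G := C_AbelianMonoid) v n =
  sum_n (G := C_AbelianMonoid) (fun k => u k - v k) n.
Proof.
  induction n as [|n IH].
  - now rewrite !sum_O.
  - rewrite !sum_Sn, <- IH. change (@plus C_AbelianMonoid) with Cplus. ring.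
Qed.

(** * Generating functions of the homogeneous Hahn polynomials *)

Section HahnGeneratingFunction.

Variables q a b x : C.
Hypothesis Hq : (Cmod q < 1)%R.
Hypothesis Ha : (Cmod a <= 1)%R.

(** Equivalently (abz q^k)_oo / ((xz q^k)_oo (bz)_oo). Keeping the finite products separate exposes
    the terms of the 2phi1 series. *)
Definition hahn_kernel (k : nat) (z : C) : C :=
  qpoch_inf (a * b * z) q / (qpoch_inf (x * z) q * qpoch_inf (b * z) q)
  * (qpoch (x * z) q k / qpoch (a * b * z) q k).

(** The closed form of G_n(z), taken as the definition; [is_Cseries_hahn] identifies it with the sum
    of the series. *)
Definition hahn_gf (n : nat) (z : C) : C :=
  sum_n (G := C_AbelianMonoid)
    (fun k => qbinom q n k * (qpoch a q k * b ^ k * hahn_kernel k z) * x ^ (n - k)) n.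

(** Keeps [qpoch (a * b * z) q k] nonzero and makes the infinite-product lemmas available at
    [a * b * z]. *)
Lemma Cmod_abz (z : C) : (Cmod (b * z) < 1)%R -> (Cmod (a * b * z) < 1)%R.
Proof. intros Hz. rewrite <- Cmult_assoc. now apply Cmod_mult_lt_1. Qed.

Lemma Cmod_mult_qshift (c z : C) : (Cmod (c * z) < 1)%R -> (Cmod (c * (q * z)) < 1)%R.
Proof.
  intros H. replace (c * (q * z)) with (q * (c * z)) by ring.
  apply Cmod_mult_lt_1; [lra | exact H].
Qed.

(** Once all infinite products are moved to the argument multiplied by [q], they form a common
    factor, and a rational identity in [q ^ k] remains. *)
Lemma hahn_kernel_qdiff (k : nat) (z : C) :
  (Cmod (x * z) < 1)%R -> (Cmod (b * z) < 1)%R ->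
  hahn_kernel k z - hahn_kernel k (q * z) =
  z * (b * (1 - q ^ k * a) * hahn_kernel (S k) z + x * q ^ k * hahn_kernel k z).
Proof.
  intros Hx Hb. pose proof (Cmod_abz z Hb) as Hab.
  unfold hahn_kernel.
  replace (a * b * (q * z)) with (q * (a * b * z)) by ring.
  replace (x * (q * z)) with (q * (x * z)) by ring.
  replace (b * (q * z)) with (q * (b * z)) by ring.
  rewrite (qpoch_inf_qshift q Hq (a * b * z)), (qpoch_inf_qshift q Hq (x * z)),
    (qpoch_inf_qshift q Hq (b * z)) by assumption.
  (* Both sides come from expanding [qpoch c q (S k)], once from each end. *)
  assert (E : forall c, (Cmod c < 1)%R ->
    qpoch (q * c) q k = qpoch c q k * (1 - q ^ k * c) / (1 - c)).
  { intros c Hc. change (qpoch c q k * (1 - q ^ k * c)) with (qpoch c q (S k)).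
    rewrite qpoch_Sl. field. now apply one_minus_neq_0. }
  rewrite !E by assumption. simpl.
  assert (Q : forall c, (Cmod c < 1)%R -> (Cmod (q * c) < 1)%R)
    by (intros c Hc; apply Cmod_mult_lt_1; lra).
  field.
  repeat split; first [now apply one_minus_neq_0 | now apply qpoch_neq_0
    | now apply one_minus_qpow_neq_0 | apply qpoch_inf_neq_0; auto].
Qed.

Lemma hahn_gf_qdiff (n : nat) (z : C) :
  (Cmod (x * z) < 1)%R -> (Cmod (b * z) < 1)%R ->
  hahn_gf n z - hahn_gf n (q * z) = z * hahn_gf (S n) z.
Proof.
  intros Hx Hb. unfold hahn_gf.
  rewrite (qbinom_sum_S q Hq x (fun k => qpoch a q k * b ^ k * hahn_kernel k z)).
  rewrite Csum_n_minus, Csum_n_mult_l. apply Csum_n_ext_loc. intros k _.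
  transitivity (qbinom q n k * (qpoch a q k * b ^ k) * x ^ (n - k)
    * (hahn_kernel k z - hahn_kernel k (q * z))); [ring|].
  rewrite hahn_kernel_qdiff by assumption. simpl. ring.
Qed.

(** At [z = 0] every product in the kernel is 1. This serves the case where dividing by [z] is
    impossible. *)
Lemma hahn_gf_0_r (n : nat) : hahn_gf n 0 = hahn q a n b x.
Proof.
  apply Csum_n_ext_loc. intros k _. unfold hahn_kernel.
  rewrite !Cmult_0_r, qpoch_inf_0_l, qpoch_0_l. field.
Qed.

(** Divided by [qpoch q q m], the Hahn polynomial is a convolution: the series is the Cauchy product
    of the q-binomial series at [b * z] and Euler's series at [x * z]. *)
Lemma is_Cseries_hahn_0 (z : C) :
  (Cmod (x * z) < 1)%R -> (Cmod (b * z) < 1)%R ->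
  is_Cseries (fun m => hahn q a m b x * (z ^ m / qpoch q q m)) (hahn_gf 0 z).
Proof.
  intros Hx Hb. pose proof (Cmod_abz z Hb) as Hab.
  eapply is_Cseries_ext; [|eapply is_Cseries_eq_sum; [|apply (is_Cseries_mult _ _ _ _
    (is_Cseries_phi10 q Hq a (b * z) Hb) (is_Cseries_euler q Hq (x * z) Hx))]].
  - intros m. rewrite (Cmult_comm (hahn q a m b x)). unfold hahn. rewrite Csum_n_mult_l.
    apply Csum_n_ext_loc. intros j Hj. unfold qbinom.
    replace (z ^ m) with (z ^ j * z ^ (m - j)) by (rewrite <- Cpow_add_r; f_equal; lia).
    rewrite !Cpow_mult_l. field. repeat split; now apply qpoch_neq_0.
  - rewrite q_binomial_theorem by (rewrite ?Cmult_assoc; assumption).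
    unfold hahn_gf. rewrite sum_O, qbinom_diag by exact Hq.
    unfold hahn_kernel. simpl. rewrite Cmult_assoc. field.
    split; now apply qpoch_inf_neq_0.
  - now apply phi10_abs_summable.
  - now apply euler_abs_summable.
Qed.

(* Dividing the q-difference of the n-th series by z raises n by one; at z = 0
   only the constant term survives. *)
Lemma is_Cseries_hahn (n : nat) (z : C) :
  (Cmod (x * z) < 1)%R -> (Cmod (b * z) < 1)%R ->
  is_Cseries (fun m => hahn q a (n + m) b x * (z ^ m / qpoch q q m)) (hahn_gf n z).
Proof.
  revert z. induction n as [|n IH]; intros z Hx Hb.
  - now apply is_Cseries_hahn_0.
  - destruct (Ceq_dec z 0) as [->|Hz].
    + rewrite hahn_gf_0_r.
      eapply is_Cseries_eq_sum; [|apply is_Cseries_single].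
      * simpl. rewrite Nat.add_0_r. field.
      * intros m. simpl. unfold Cdiv. ring.
    + pose proof (is_Cseries_shift _ _ (is_Cseries_minus _ _ _ _ (IH z Hx Hb)
        (IH (q * z) (Cmod_mult_qshift x z Hx) (Cmod_mult_qshift b z Hb)))) as D.
      eapply is_Cseries_ext; [|eapply is_Cseries_eq_sum; [|exact (is_Cseries_scal (/ z) _ _ D)]].
      (* The q-difference contributes [1 - q ^ m * q], which cancels the last factor of
         [qpoch q q (S m)], while [n + S m] becomes [S n + m]. *)
      * intros m. simpl. rewrite Nat.add_succ_r, Cpow_mult_l. field.
        repeat split; first [exact Hz | now apply qpoch_neq_0 | now apply one_minus_qpow_neq_0].
      * rewrite hahn_gf_qdiff by assumption. simpl. field. exact Hz.
Qed.

(** The factor [qpoch q q n] cancels against the q-binomial coefficient, leaving G_0(z) times the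
    convolution of the 2phi1 terms at [b * y] with Euler's terms at [x * y]. *)
Lemma is_Cseries_hahn_gf (y z : C) :
  (Cmod (x * y) < 1)%R -> (Cmod (x * z) < 1)%R ->
  (Cmod (b * y) < 1)%R -> (Cmod (b * z) < 1)%R ->
  is_Cseries (fun n => y ^ n / qpoch q q n * hahn_gf n z)
    (qpoch_inf (a * b * z) q
       / (qpoch_inf (x * y) q * qpoch_inf (x * z) q * qpoch_inf (b * z) q)
     * phi21 a (x * z) (a * b * z) q (b * y)).
Proof.
  intros Hxy Hxz Hby Hbz. pose proof (Cmod_abz z Hbz) as Hab.
  pose proof (phi21_abs_summable q Hq a (x * z) (a * b * z) (b * y) Hab Hby) as A.
  pose proof (is_Cseries_mult _ _ _ _ (CSeries_correct _ (abs_summable_ex _ A))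
    (is_Cseries_euler q Hq (x * y) Hxy) A (euler_abs_summable q Hq (x * y) Hxy)) as M.
  apply (is_Cseries_scal
    (qpoch_inf (a * b * z) q / (qpoch_inf (x * z) q * qpoch_inf (b * z) q))) in M.
  eapply is_Cseries_ext; [|eapply is_Cseries_eq_sum; [|exact M]].
  - intros n. unfold hahn_gf. rewrite !Csum_n_mult_l.
    apply Csum_n_ext_loc. intros k Hk. unfold qbinom, hahn_kernel.
    replace (y ^ n) with (y ^ k * y ^ (n - k)) by (rewrite <- Cpow_add_r; f_equal; lia).
    rewrite !Cpow_mult_l. field.
    repeat split; first [now apply qpoch_neq_0 | now apply qpoch_inf_neq_0].
  - unfold phi21. field. repeat split; now apply qpoch_inf_neq_0.
Qed.

End HahnGeneratingFunction.

(** The double sum is iterated, with [m] innermost. Convergence of each inner series is asserted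
    separately, because [CSeries] has a meaning only then. *)
Theorem theorem13 :
  forall (q : C) (k : nat) (b x y z : C),
    (Cmod q < 1)%R ->
    (Cmod (x * y) < 1)%R ->
    (Cmod (x * z) < 1)%R ->
    (Cmod (b * y) < 1)%R ->
    (Cmod (b * z) < 1)%R ->
    let term (n m : nat) : C :=
      hahn q (q ^ k) (n + m) b x
        * (y ^ n / qpoch q q n) * (z ^ m / qpoch q q m) in
    (forall n : nat, ex_Cseries (term n)) /\
    is_Cseries (fun n => CSeries (term n))
      (qpoch_inf (q ^ k * b * z) q
         / (qpoch_inf (x * y) q * qpoch_inf (x * z) q * qpoch_inf (b * z) q)
       * phi21 (q ^ k) (x * z) (q ^ k * b * z) q (b * y)).
Proof.
  intros q k b x y z Hq Hxy Hxz Hby Hbz term.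
  (* [q ^ k] is the section parameter [a]; the bound is not strict because [k = 0] gives 1. *)
  assert (Hk : (Cmod (q ^ k) <= 1)%R) by (apply Cmod_pow_le_1; lra).
  assert (T : forall n, is_Cseries (term n) (y ^ n / qpoch q q n * hahn_gf q (q ^ k) b x n z)).
  { intros n. eapply is_Cseries_ext;
      [|exact (is_Cseries_scal _ _ _ (is_Cseries_hahn q (q ^ k) b x Hq Hk n z Hxz Hbz))].
    intros m. unfold term. simpl. ring. }
  split.
  - intros n. eexists. apply T.
  - eapply is_Cseries_ext.
    + intros n. symmetry. apply CSeries_eq, T.
    + now apply is_Cseries_hahn_gf.
Qed.
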